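(* Let $m,n\geq 1$ and $k\geq 0$ be integers with $(m,k)\neq(1,0)$. Write $n=bn'$, where $\gcd(n',m)=1$ and every prime divisor of $b$ divides $m$. Assume that $K\cap\mathbb{Q}(\mu_{mn})=\mathbb{Q}$. Then $$\mathrm{N}_{K(\mu_{mn})/K(\mu_m)}\bigl(c_{mn,k}\bigr)=\prod_{e\mid \mathrm{rad}(n')}\sigma_{e^{-1}}\bigl(c_{m,(n/e)k}\bigr)^{\mu(e)},$$ where $e$ runs over all positive divisors of $\mathrm{rad}(n')$, $e^{-1}$ denotes the inverse of $e$ modulo $m$, and $\mathrm N$ is the relative field norm.
   Context: Let $D>1$ be a square-free integer and $K=\mathbb{Q}(\sqrt D)\subset\overline{\mathbb{Q}}$. Let $u>1$ be the fundamental unit of $K$ (at the real embedding with $\sqrt D>0$), and put $\varepsilon=u$ if $\mathrm{N}_{K/\mathbb{Q}}(u)=1$ and $\varepsilon=u^2$ if $\mathrm{N}_{K/\mathbb{Q}}(u)=-1$, so $\varepsilon$ is totally positive of norm $1$. Fix primitive $m$-th roots of unity $\zeta_m\in\overline{\mathbb{Q}}$ for all $m\ge1$ that are power-compatible: $\zeta_{mn}^{\,n}=\zeta_m$ for all $m,n\geq1$. Let $\mu_m$ be the group of $m$-th roots of unity. For $m\geq1$, $k\geq0$ put $c_{m,k}:=1-\zeta_m\varepsilon^k\in K(\mu_m)$. When $K\cap\mathbb{Q}(\mu_m)=\mathbb{Q}$ and $a\in(\mathbb{Z}/m\mathbb{Z})^\times$, $\sigma_a$ denotes the automorphism of $K(\mu_m)/K$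 that fixes $K$ and sends $\zeta_m$ to $\zeta_m^a$; for $m=1$ every $\sigma_a$ is the identity. $\mu(e)$ is the Möbius function, and $\mathrm{rad}(N)$ is the product of the distinct primes dividing $N$. *)

(* Defs.v *)
From HB Require Import structures.
From mathcomp Require Import all_boot all_order all_algebra all_fingroup all_field.

Set Implicit Arguments.
Unset Strict Implicit.
Unset Printing Implicit Defensive.

Import Order.TTheory GRing.Theory Num.Theory.

Local Open Scope ring_scope.

(* The algebraic closure of Q is algC.  The number fields involved are         *)
(* {subfield L} of an ambient normal number field L : splittingFieldType rat   *)
(* embedded in algC by phi; L only has to be large enough to contain them, and *)
(* galNorm and 'Gal(_ / _) do not depend on it.                                *)

Definition squarefree (n : nat) : bool :=
  (0 < n)%N && all (fun p => ~~ (p ^ 2 %| n)%N) (primes n).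

Definition mobius (n : nat) : int :=
  if squarefree n then (-1) ^+ size (primes n) else 0.

Definition radn (n : nat) : nat := (\prod_(p <- primes n) p)%N.

(* For e > 0 prime to m, egcdn e m = (u, v) with e * u - m * v = 1. *)
Definition modinv (e m : nat) : nat := (egcdn e m).1.

Section NumberFields.
Variable L : splittingFieldType rat.

(* K(mu_m), for z a primitive m-th root of unity. *)
Definition adjoin_mu (K : {subfield L}) (m : nat) (z : L) : {subfield L} :=
  <<K & [seq z ^+ i | i <- seq.iota 0 m]>>%AS.

(* x is a unit of the ring of integers of K.  The inverse being total,         *)
(* x != 0 is required, as 0^-1 = 0 is an algebraic integer.                    *)
Definition int_unit (phi : {rmorphism L -> algC}) (K : {subfield L}) (x : L) :=
  [/\ x \in K, x != 0, phi x \in Aint & phi x^-1 \in Aint].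

(* For K real quadratic: u > 1 at the real place phi, and the units of K are   *)
(* the +/- u ^ j.  In algC, 1 < x entails that x is real.                      *)
Definition fundamental_unit (phi : {rmorphism L -> algC}) (K : {subfield L})
    (u : L) :=
  [/\ int_unit phi K u, 1 < phi u
    & forall v : L, int_unit phi K v ->
        exists (s : bool) (j : int), v = (-1) ^+ s * u ^ j].

(* The norm of a unit u is 1 or -1, so the second branch is norm -1. *)
Definition norm1_unit (K : {subfield L}) (u : L) : L :=
  if galNorm 1%AS K u == 1 then u else u ^+ 2.

(* sigma_a in Gal(K(mu_m) / K): the unique element raising z = zeta_m to the   *)
(* power a (the default is irrelevant when such an element exists).            *)
Definition sigma (K : {subfield L}) (m : nat) (z : L) (a : nat) :
    gal_of (adjoin_mu K m z) :=
  odflt 1%g [pick s in 'Gal(adjoin_mu K m z / K)%g | s z == z ^+ a].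

(* c_{m,k}, for z = zeta_m. *)
Definition cunit (z eps : L) (k : nat) : L := 1 - z * eps ^+ k.

End NumberFields.

(* Main.v *)
Require Import Defs.
From HB Require Import structures.
From mathcomp Require Import all_boot all_order all_algebra all_fingroup all_field.

Set Implicit Arguments.
Unset Strict Implicit.
Unset Printing Implicit Defensive.

Import Order.TTheory GRing.Theory Num.Theory.

Local Open Scope ring_scope.

(* Since K :&: Q(mu_mn) = Q, the automorphisms of K(mu_mn) over K(mu_m) are the
   z |-> z ^+ a with a prime to mn and a = 1 mod m, so the norm is the product of
   the 1 - z ^+ a * eps ^+ k over these a.  Only coprimality of a with rad(n') has
   to be imposed on top of a = 1 mod m; removing this condition by Moebius
   inversion leaves, for each e | rad(n'), a product over a full residue class,
   which is evaluated by \prod_(i < q) (1 - w ^+ i * y) = 1 - y ^+ q for w a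
   primitive q-th root of unity. *)

(** * Arithmetic: Moebius sums, radicals and inverses modulo m *)

Lemma coprime_no_prime (a b : nat) : (0 < b)%N ->
  (forall p, prime p -> (p %| a)%N -> (p %| b)%N -> False) -> coprime a b.
Proof.
move=> b_gt0 no_p; rewrite /coprime; case: eqP => // /eqP ng1.
have g_gt1: (1 < gcdn a b)%N by rewrite ltn_neqAle eq_sym ng1 gcdn_gt0 b_gt0 orbT.
have pg := pdiv_dvd (gcdn a b).
case: (no_p _ (pdiv_prime g_gt1)); apply: (dvdn_trans pg).
- exact: dvdn_gcdl.
- exact: dvdn_gcdr.
Qed.

Lemma squarefree_dvd (d e : nat) : (e %| d)%N -> squarefree d -> squarefree e.
Proof.
move=> ed /andP[d_gt0 /allP sqf]; have e_gt0 := dvdn_gt0 d_gt0 ed.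
rewrite /squarefree e_gt0; apply/allP => p; rewrite mem_primes => /and3P[p_pr _ pe].
apply: contra (sqf p _) => [p2e|]; first exact: dvdn_trans ed.
by rewrite mem_primes p_pr d_gt0 (dvdn_trans pe).
Qed.

Lemma mobius_primeM (p e : nat) :
  prime p -> squarefree (p * e) -> mobius (p * e) = - mobius e.
Proof.
move=> p_pr sqf; have sqf_e := squarefree_dvd (dvdn_mull p (dvdnn e)) sqf.
rewrite /mobius sqf sqf_e -[RHS]mulN1r -exprS; congr (_ ^+ _).
have /andP[pe_gt0 /allP np2] := sqf.
have [p_gt0 e_gt0]: (0 < p)%N /\ (0 < e)%N by apply/andP; rewrite -muln_gt0.
have p'e: p \notin primes e.
  rewrite mem_primes p_pr e_gt0; apply: contra (np2 p _) => [pe|].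
    by rewrite dvdn_pmul2l.
  by rewrite mem_primes p_pr pe_gt0 dvdn_mulr.
have -> : (size (primes e)).+1 = size (p :: primes e) by [].
apply/perm_size/uniq_perm; rewrite /= ?primes_uniq ?p'e // => q.
by rewrite primesM // primes_prime // !inE.
Qed.

(** Write d = p * c with p its least prime factor. As p does not divide c, the divisors of d are the
    divisors e of c together with the p * e, and these cancel in pairs. *)
Lemma sum_mobius_divisors (d : nat) :
  squarefree d -> \sum_(e <- divisors d) mobius e = (d == 1)%N.
Proof.
move=> sqf; have /andP[d_gt0 /allP np2] := sqf.
have [->|d_neq1] := eqVneq d 1; first by rewrite big_seq1.
have d_gt1 : (1 < d)%N by rewrite ltn_neqAle eq_sym d_neq1.
have p_pr := pdiv_prime d_gt1; set p := pdiv d in p_pr.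
have /dvdnP[c dE] := pdiv_dvd d; rewrite -/p mulnC in dE.
have p_gt0 := prime_gt0 p_pr.
have c_gt0 : (0 < c)%N by move: d_gt0; rewrite dE muln_gt0 => /andP[].
have p'c : ~~ (p %| c)%N.
  apply: contra (np2 p _) => [pc|]; first by rewrite dE dvdn_pmul2l.
  by rewrite mem_primes p_pr d_gt0 pdiv_dvd.
have perm_d : perm_eq (divisors d) (divisors c ++ [seq p * e | e <- divisors c]%N).
  apply: uniq_perm => [||e]; first exact: divisors_uniq.
    rewrite cat_uniq divisors_uniq map_inj_uniq ?divisors_uniq ?andbT; last first.
      by move=> i j /eqP; rewrite eqn_pmul2l // => /eqP.
    apply/hasPn => _ /mapP[e _ ->] /=; rewrite -dvdn_divisors //.
    by apply: contra p'c; apply: dvdn_trans; apply: dvdn_mulr.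
  rewrite mem_cat -!dvdn_divisors // dE.
  apply/idP/orP => [e_pc | [ec | /mapP[f]]].
  - have [/dvdnP[f eE] | p'e] := boolP (p %| e)%N; [right | left].
      move: e_pc; rewrite eE mulnC dvdn_pmul2l // => fc.
      by apply/mapP; exists f; rewrite -?dvdn_divisors.
    by move: e_pc; rewrite Gauss_dvdr // coprime_sym prime_coprime.
  - exact: dvdn_mull.
  - by rewrite -dvdn_divisors // => fc ->; rewrite dvdn_pmul2l.
rewrite (perm_big _ perm_d) big_cat big_map /= -big_split big_seq big1 // => e.
rewrite -dvdn_divisors // => ec; rewrite /= mobius_primeM ?subrr //.
by apply: squarefree_dvd sqf; rewrite dE dvdn_pmul2l.
Qed.

Lemma prime_dvd_radn (n p : nat) :
  (0 < n)%N -> prime p -> (p %| radn n)%N = (p %| n)%N.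
Proof.
move=> n_gt0 p_pr; rewrite /radn; apply/idP/idP => [|pn].
  rewrite Euclid_dvd_prod // big_has => /hasP[q].
  rewrite mem_primes => /and3P[q_pr _ qn].
  by rewrite dvdn_prime2 // => /eqP->.
by rewrite (big_rem p) ?dvdn_mulr //= mem_primes p_pr n_gt0.
Qed.

Lemma radn_gt0 (n : nat) : (0 < radn n)%N.
Proof.
rewrite /radn big_seq prodn_cond_gt0 // => p.
by rewrite mem_primes => /andP[/prime_gt0].
Qed.

Lemma squarefree_radn (n : nat) : squarefree (radn n).
Proof.
rewrite /squarefree radn_gt0; apply/allP => p.
rewrite mem_primes => /and3P[p_pr _]; rewrite {1}/radn Euclid_dvd_prod // big_has.
case/hasP => q qn; have := qn; rewrite mem_primes => /and3P[q_pr _ _].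
rewrite dvdn_prime2 // => /eqP p_eq_q; rewrite -p_eq_q {q q_pr p_eq_q} in qn.
(* Cancelling one p from p ^ 2 leaves p dividing a product of primes all different from p. *)
rewrite /radn (big_rem p) //= dvdn_pmul2l ?prime_gt0 // Euclid_dvd_prod // big_has.
apply/hasPn => q; rewrite mem_rem_uniq ?primes_uniq // !inE => /andP[q_neq_p].
rewrite mem_primes => /andP[q_pr _].
by rewrite dvdn_prime2 // eq_sym.
Qed.

Lemma radn_dvd (n : nat) : (0 < n)%N -> (radn n %| n)%N.
Proof.
move=> n_gt0; rewrite {2}(prod_prime_decomp n_gt0) /radn prime_decompE big_map /=.
rewrite big_seq [X in (_ %| X)%N]big_seq.
apply: (big_ind2 (fun d e => d %| e)%N) => // [*|p]; first exact: dvdn_mul.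
by rewrite -logn_gt0 => logn_p; apply: dvdn_exp.
Qed.

(** The divisors of r that divide a are those of [gcdn a r]. This is the coprimality indicator used
    for Moebius inversion. *)
Lemma sum_mobius_gcdn (a r : nat) : squarefree r ->
  \sum_(e <- divisors r | (e %| a)%N) mobius e = coprime a r.
Proof.
move=> sqf; have r_gt0 : (0 < r)%N by case/andP: sqf.
have g_gt0 : (0 < gcdn a r)%N by rewrite gcdn_gt0 r_gt0 orbT.
rewrite -sum_mobius_divisors; last by apply: squarefree_dvd sqf; apply: dvdn_gcdr.
rewrite -big_filter; apply/perm_big/uniq_perm => [||e].
- by rewrite filter_uniq ?divisors_uniq.
- exact: divisors_uniq.
- by rewrite mem_filter -!dvdn_divisors // dvdn_gcd.
Qed.

Lemma modinvP (e m : nat) : (0 < e)%N -> coprime e m -> e * modinv e m = 1 %[mod m].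
Proof.
move=> e_gt0 /eqP co_em; rewrite /modinv; case: egcdnP => // u v eq_uv _ /=.
by rewrite mulnC eq_uv co_em modnMDl.
Qed.

(** * Products of 1 - z ^+ a * x over residue classes of exponents *)

(** For y != 0, evaluate the factorization of X^q - 1 at y^-1 and multiply by y ^+ q. *)
Lemma prod_one_sub_prim_root (F : fieldType) (q : nat) (w y : F) :
  q.-primitive_root w -> \prod_(i < q) (1 - w ^+ i * y) = 1 - y ^+ q.
Proof.
move=> prim_w; have q_gt0 := prim_order_gt0 prim_w.
have [->|y_neq0] := eqVneq y 0.
  by rewrite expr0n gtn_eqF // subr0 big1 // => i _; rewrite mulr0 subr0.
transitivity (\prod_(i < q) (y * (y^-1 - w ^+ i))).
  by apply: eq_bigr => i _; rewrite mulrBr divff // mulrC.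
rewrite big_split prodr_const card_ord /=.
have /(congr1 (horner^~ y^-1)) := factor_Xn_sub_1 prim_w.
rewrite horner_prod !hornerE big_mkord => E.
under eq_bigr do rewrite -hornerXsubC.
by rewrite E mulrBr mulr1 -exprMn divff // expr1n.
Qed.

(** The exponents are f %% m + m * j with j < q, and z ^+ m is a primitive q-th root of unity. *)
Lemma prod_one_sub_modn (F : fieldType) (m q f : nat) (z x : F) :
  (m * q).-primitive_root z ->
  \prod_(a < m * q | a == f %[mod m]) (1 - z ^+ a * x)
    = 1 - z ^+ (q * f) * x ^+ q.
Proof.
move=> prim_z; have := prim_order_gt0 prim_z; rewrite muln_gt0 => /andP[m_gt0 q_gt0].
(* The successor form of q lets [inord] land in the index type of j. *)
case: q q_gt0 prim_z => // q _ prim_z.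
have f0_lt : (f %% m < m)%N by rewrite ltn_mod.
have lt_mq (j : 'I_q.+1) : (f %% m + m * j < m * q.+1)%N.
  apply: (@leq_trans (m * j.+1)%N); first by rewrite mulnS ltn_add2r.
  by rewrite leq_pmul2l.
rewrite (reindex_onto (fun j => Ordinal (lt_mq j))
  (fun a => inord (a %/ m))); last first.
  move=> a /eqP a_f; apply/val_inj => /=.
  rewrite inordK; last by rewrite ltn_divLR // [(_ * m)%N]mulnC.
  by rewrite -a_f addnC mulnC -divn_eq.
transitivity (\prod_(j < q.+1) (1 - (z ^+ m) ^+ j * (z ^+ (f %% m) * x))).
  apply: eq_big => [j|j _] /=; last by rewrite exprD exprM mulrA (mulrC (z ^+ _ ^+ _)).
  rewrite [(m * j)%N]mulnC addnC modnMDl modn_mod eqxx /=; apply/eqP/val_inj => /=.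
  by rewrite divnMDl // [(_ %% _ %/ _)%N]divn_small // addn0 inordK.
rewrite prod_one_sub_prim_root; last first.
  by have := dvdn_prim_root prim_z (dvdn_mull m (dvdnn q.+1)); rewrite mulnK.
congr (1 - _); rewrite exprMn -exprM; congr (_ * _); apply/eqP.
by rewrite (eq_prim_root_expr prim_z) [(q.+1 * f)%N]mulnC -!muln_modl // modn_mod.
Qed.

(** Put a = e * b: since f inverts e modulo m, a = 1 mod m amounts to b = f mod m. *)
Lemma prod_dvdn_modn (R : comPzRingType) (m q e f : nat) (G : nat -> R) :
  (0 < e)%N -> (e * f = 1 %[mod m]) ->
  \prod_(a < m * (e * q) | (a == 1 %[mod m]) && (e %| a)%N) G a
    = \prod_(b < m * q | b == f %[mod m]) G (e * b)%N.
Proof.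
move=> e_gt0 ef1.
have lt_e (b : 'I_(m * q)) : (e * b < m * (e * q))%N by rewrite mulnCA ltn_pmul2l.
have lt_div (a : 'I_(m * (e * q))) : (a %/ e < m * q)%N.
  by rewrite ltn_divLR // -mulnA [(q * e)%N]mulnC.
rewrite (reindex_onto (fun b => Ordinal (lt_e b)) (fun a => Ordinal (lt_div a))).
  apply: eq_bigl => b /=.
  rewrite dvdn_mulr // andbT; have -> : Ordinal (lt_div (Ordinal (lt_e b))) == b.
    by apply/eqP/val_inj; rewrite /= mulKn.
  rewrite andbT; apply/eqP/eqP => [eb1 | b_f].
    rewrite -[b : nat]mul1n -modnMml -ef1 modnMml [(e * f)%N]mulnC -mulnA -modnMmr eb1.
    by rewrite modnMmr muln1.
  by rewrite -modnMmr b_f modnMmr.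
by move=> a /andP[_ e_a]; apply/val_inj; rewrite /= mulnC divnK.
Qed.

(* The non-vanishing hypothesis makes every factor 1 - z ^+ a * x with
   a = 1 mod m invertible, as required to split its exponent into a sum of mu(e). *)
Lemma prod_coprime_modn (F : fieldType) (m n b n' : nat) (z x : F) :
  n = (b * n')%N -> coprime n' m ->
  (forall p : nat, prime p -> (p %| b)%N -> (p %| m)%N) ->
  (m * n).-primitive_root z -> 1 - z ^+ n * x ^+ n != 0 ->
  \prod_(a < m * n | coprime a (m * n) && (a == 1 %[mod m])) (1 - z ^+ a * x)
  = \prod_(e <- divisors (radn n'))
      (1 - z ^+ (n * modinv e m) * x ^+ (n %/ e)) ^ (mobius e).
Proof.
move=> n_eq co_n'm b_m prim_z nz.
have := prim_order_gt0 prim_z; rewrite muln_gt0 => /andP[m_gt0 n_gt0].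
have [b_gt0 n'_gt0] : (0 < b /\ 0 < n')%N.
  by apply/andP; rewrite -muln_gt0 -n_eq.
(* The product over the whole class of 1 is 1 - z ^+ n * x ^+ n, so no factor vanishes. *)
have nz_a (a : 'I_(m * n)) : a == 1 %[mod m] -> 1 - z ^+ a * x != 0.
  move=> a1; move: nz; have := prod_one_sub_modn 1 x prim_z; rewrite muln1 => <-.
  by move/prodf_neq0; apply.
(* The congruence makes a prime to m, hence to b, whose primes divide m; and n' has the same primes
   as its radical. *)
have co_r (a : nat) : a == 1 %[mod m] -> coprime a (m * n) = coprime a (radn n').
  move=> /eqP a1; have co_am : coprime a m.
    by rewrite -coprime_modl a1 coprime_modl coprime1n.
  rewrite coprimeMr co_am n_eq coprimeMr.
  have -> : coprime a b.
    apply: coprime_no_prime => // p p_pr pa /(b_m _ p_pr) pm.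
    have : (p %| gcdn a m)%N by rewrite dvdn_gcd pa.
    by rewrite (eqP co_am) dvdn1 => /eqP p1; rewrite p1 in p_pr.
  apply/idP/idP => co; apply: coprime_no_prime; rewrite ?radn_gt0 // => p p_pr pa;
    rewrite ?prime_dvd_radn // => pn'.
    have : (p %| gcdn a n')%N by rewrite dvdn_gcd pa.
    by rewrite (eqP co) dvdn1 => /eqP p1; rewrite p1 in p_pr.
  have : (p %| gcdn a (radn n'))%N by rewrite dvdn_gcd pa prime_dvd_radn.
  by rewrite (eqP co) dvdn1 => /eqP p1; rewrite p1 in p_pr.
transitivity (\prod_(a < m * n | a == 1 %[mod m])
    \prod_(e <- divisors (radn n') | (e %| a)%N) (1 - z ^+ a * x) ^ (mobius e)).
  rewrite [LHS]big_mkcondl; apply: eq_bigr => a a1.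
  rewrite -(big_morph _ (fun i j => expfzDr i j (nz_a a a1)) (expr0z _)).
  by rewrite sum_mobius_gcdn ?squarefree_radn // co_r //; case: coprime.
(* With e outermost, each inner product runs over the multiples of e in the class of 1, and is
   evaluated with z ^+ e as root of unity. *)
rewrite (exchange_big_dep xpredT) //= big_seq [RHS]big_seq; apply: eq_bigr => e.
rewrite -dvdn_divisors ?radn_gt0 // => e_r.
have e_n' := dvdn_trans e_r (radn_dvd n'_gt0); have e_gt0 := dvdn_gt0 n'_gt0 e_n'.
have co_em : coprime e m by apply: coprime_dvdl co_n'm.
have /dvdnP[q n_qe] : (e %| n)%N by rewrite n_eq dvdn_mull.
have ef1 := modinvP e_gt0 co_em; set f := modinv e m in ef1 *.
rewrite -(big_morph (fun u : F => u ^ mobius e) (fun u v => expfzMl u v _) (exp1rz _ _)).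
congr (_ ^ _); rewrite n_qe mulnK // [(q * e)%N]mulnC in prim_z *.
rewrite (prod_dvdn_modn q (fun a => 1 - z ^+ a * x) e_gt0 ef1).
under eq_bigr do rewrite exprM.
rewrite prod_one_sub_modn -?exprM ?mulnA //.
have := dvdn_prim_root prim_z (dvdn_mul (dvdnn m) (dvdn_mull e (dvdnn q))).
by have := prim_order_gt0 prim_z; rewrite mulnCA muln_gt0 => /andP[_ /mulnK->].
Qed.

(** * Galois theory of K(mu_N) over K *)

Section CyclotomicExtension.
Variable L : splittingFieldType rat.
Implicit Types (K E : {subfield L}) (z : L).

Lemma pchar_rat_splittingField : [pchar L] =i pred0.
Proof. by move=> p; rewrite (fmorph_pchar (in_alg L)) pchar_num. Qed.

Lemma galois_full K : galois K {:L}.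
Proof.
rewrite /galois subvf normalFieldf andbT; apply/separableP => y _.
exact/pcharf0_separable/pchar_rat_splittingField.
Qed.

Lemma sub_adjoin_mu K N z : (K <= adjoin_mu K N z)%VS.
Proof. exact: subv_adjoin_seq. Qed.

Lemma mem_adjoin_mu K N z : N.-primitive_root z -> z \in adjoin_mu K N z.
Proof.
move=> prim_z; have N_gt0 := prim_order_gt0 prim_z.
have [_] := Fadjoin_seqP (subvv (adjoin_mu K N z)); apply.
apply/mapP; exists (1 %% N)%N; first by rewrite mem_iota ltn_mod.
by rewrite (prim_expr_mod prim_z).
Qed.

Lemma adjoin_mu_subP K E N z :
  (K <= E)%VS -> z \in E -> (adjoin_mu K N z <= E)%VS.
Proof.
move=> sKE Ez; apply/Fadjoin_seqP; split=> // _ /mapP[i _ ->].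
exact: rpredX.
Qed.

(** It is the splitting field of X^N - 1, which is separable in characteristic 0. *)
Lemma galois_adjoin_mu K N z : N.-primitive_root z -> galois K (adjoin_mu K N z).
Proof.
move=> prim_z; have N_gt0 := prim_order_gt0 prim_z.
apply/splitting_galoisField; exists ('X^N - 1); split.
- by rewrite rpredB ?rpredX ?polyOverX ?rpred1.
- by rewrite separable_Xn_sub_1 // ((pcharf0P L).1 pchar_rat_splittingField) -lt0n.
- exists [seq z ^+ i | i <- seq.iota 0 N] => //.
  by rewrite big_map -(factor_Xn_sub_1 prim_z) /index_iota subn0 eqpxx.
Qed.

(** An automorphism of [algC] raising N-th roots of unity to the power a restricts to L along [phi],
    as L is normal. *)
Lemma gal_full_exists (phi : {rmorphism L -> algC}) N z a :
  N.-primitive_root z -> coprime a N ->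
  exists2 s, s \in 'Gal({:L} / 1)%g & s z = z ^+ a.
Proof.
move=> prim_z co_aN; have [nu nuE] := Qn_aut_exists co_aN.
have [nu0 nu0E] := restrict_aut_to_normal_num_field phi nu.
have nu0z : nu0 z = z ^+ a.
  apply: (fmorph_inj phi); rewrite nu0E nuE ?rmorphXn //.
  by rewrite -rmorphXn (prim_expr_order prim_z) rmorph1.
have kAut_nu : kAut 1 {:L} (linfun nu0).
  by rewrite kAutfE k1HomE linfun_is_ahom.
have [s s_gal sE] := kAut_to_gal kAut_nu.
by exists s => //; rewrite -sE ?memvf // lfunE.
Qed.

(* Restriction to Q(z) maps Gal(L/K) onto Gal(Q(z)/Q), since its image has the
   fixed field K :&: Q(z) = Q. *)
Lemma gal_adjoin_mu_exists (phi : {rmorphism L -> algC}) K N z a :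
  N.-primitive_root z -> coprime a N ->
  (K :&: adjoin_mu 1%AS N z)%VS = 1%VS ->
  exists2 s, s \in 'Gal(adjoin_mu K N z / K)%g & s z = z ^+ a.
Proof.
move=> prim_z co_aN disj; set M := adjoin_mu 1 N z in disj.
have Mz : z \in M by apply: mem_adjoin_mu.
have galM : galois 1 M by apply: galois_adjoin_mu.
have nM : normalField 1 M by case/and3P: galM.
have sM : (1 <= M <= {:L})%VS by rewrite sub1v subvf.
have [s s_gal sz] := gal_full_exists phi prim_z co_aN.
have resE := normalField_cast_eq sM nM.
have sub1K : 'Gal({:L} / K)%g \subset 'Gal({:L} / 1)%g by apply: galS; apply: sub1v.
pose res := normalField_cast_morphism sM nM.
have fixedH : fixedField (res @* 'Gal({:L} / K))%g = 1%VS.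
  (* An x in Q(z) fixed by all restrictions is fixed by Gal(L/K), hence lies in K. *)
  apply/eqP; rewrite eqEsubv sub1v andbT -disj; apply/subvP => x.
  case/mem_fixedFieldP => Mx fix_x; rewrite memv_cap Mx andbT.
  move/galois_fixedField: (galois_full K) => <-.
  apply/fixedFieldP; rewrite ?memvf // => t t_gal.
  rewrite -(resE t) ?(subsetP sub1K) //; apply: fix_x; apply: mem_morphim => //.
  exact: (subsetP sub1K).
have : res s \in 'Gal(M / 1)%g.
  rewrite -(normalField_img (galois_full 1) sM nM); exact: mem_morphim.
(* By the Galois correspondence the image is all of Gal(Q(z)/Q), so s agrees on Q(z) with some t
   fixing K; t is then restricted to K(mu_N). *)
rewrite -fixedH gal_fixedField => /morphimP[t _ t_gal /= res_st].
have tz : t z = z ^+ a.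
  by rewrite -(resE t) ?(subsetP sub1K) // -res_st resE.
have galE : galois K (adjoin_mu K N z) by apply: galois_adjoin_mu.
have nE : normalField K (adjoin_mu K N z) by case/and3P: galE.
have sE : (K <= adjoin_mu K N z <= {:L})%VS by rewrite sub_adjoin_mu subvf.
exists (normalField_cast (adjoin_mu K N z) t).
  rewrite -(normalField_img (galois_full K) sE nE); exact: mem_morphim.
by rewrite (normalField_cast_eq sE nE) // mem_adjoin_mu.
Qed.

Lemma adjoin_muE K N z : N.-primitive_root z -> adjoin_mu K N z = <<K; z>>%AS.
Proof.
move=> prim_z; apply/val_inj/eqP; rewrite /= eqEsubv adjoin_mu_subP ?memv_adjoin //=.
  by apply/FadjoinP; rewrite sub_adjoin_mu mem_adjoin_mu.
exact: subv_adjoin.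
Qed.

(** K(mu_N) is generated over K by z alone. *)
Lemma gal_adjoin_mu_inj K N z (s t : gal_of (adjoin_mu K N z)) :
  N.-primitive_root z ->
  s \in 'Gal(adjoin_mu K N z / K)%g -> t \in 'Gal(adjoin_mu K N z / K)%g ->
  s z = t z -> s = t.
Proof.
move=> prim_z; move: s t; rewrite (adjoin_muE K prim_z) => s t s_gal t_gal eq_z.
by apply/eqP; rewrite gal_adjoin_eq // eq_z.
Qed.

(** The elements fixed by s form a field; once it contains K and z, it contains K(mu_m). *)
Lemma gal_adjoin_mu_fix K E m z (s : gal_of E) :
  m.-primitive_root z -> (adjoin_mu K m z <= E)%VS ->
  (s \in 'Gal(E / adjoin_mu K m z)%g) = (s \in 'Gal(E / K)%g) && (s z == z).
Proof.
move=> prim_z sE; have sKE := subv_trans (sub_adjoin_mu K m z) sE.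
apply/idP/andP=> [s_gal | [s_gal /eqP sz]].
  rewrite (subsetP (galS _ (sub_adjoin_mu K m z))) //.
  by rewrite (fixed_gal sE s_gal) ?mem_adjoin_mu.
rewrite gal_kHom //; apply/kAHomP => x.
have : (adjoin_mu K m z <= fixedSpace_aspace s)%VS.
  apply: adjoin_mu_subP; last exact/fixedSpaceP.
  by apply/subvP => y Ky; apply/fixedSpaceP; apply: fixed_gal Ky.
by move/subvP/(_ x) => fx /fx /fixedSpaceP.
Qed.

(** Disjointness provides an automorphism with z |-> z ^+ a, so the default in [sigma] is never
    taken. *)
Lemma sigma_cunit (phi : {rmorphism L -> algC}) K m z eps a j :
  m.-primitive_root z -> coprime a m -> (K :&: adjoin_mu 1%AS m z)%VS = 1%VS ->
  eps \in K -> sigma K m z a (cunit z eps j) = 1 - z ^+ a * eps ^+ j.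
Proof.
move=> prim_z co_am disj K_eps; rewrite /sigma /cunit.
case: pickP => [s /andP[s_gal /eqP sz] | no_s] /=.
  rewrite rmorphB rmorph1 rmorphM rmorphXn /= sz.
  by rewrite (fixed_gal (sub_adjoin_mu K m z) s_gal).
have [s s_gal sz] := gal_adjoin_mu_exists phi prim_z co_am disj.
by have := no_s s; rewrite s_gal sz eqxx.
Qed.

(** Reindex the Galois group by the exponent a of s z = z ^+ a: fixing z ^+ n, of order m, means a =
    1 mod m. *)
Lemma galNorm_adjoin_mu (phi : {rmorphism L -> algC}) K m n z x :
  (m * n).-primitive_root z -> (K :&: adjoin_mu 1%AS (m * n) z)%VS = 1%VS ->
  x \in K ->
  galNorm (adjoin_mu K m (z ^+ n)) (adjoin_mu K (m * n) z) (1 - z * x)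
  = \prod_(a < m * n | coprime a (m * n) && (a == 1 %[mod m])) (1 - z ^+ a * x).
Proof.
move=> prim_z disj Kx; set E := adjoin_mu K (m * n) z; set E' := adjoin_mu K m _.
have N_gt0 := prim_order_gt0 prim_z.
have prim_zn : m.-primitive_root (z ^+ n).
  have := dvdn_prim_root prim_z (dvdn_mulr n (dvdnn m)).
  by move: N_gt0; rewrite muln_gt0 => /andP[/mulKn->].
have Ez : z \in E by apply: mem_adjoin_mu.
have sKE : (K <= E)%VS by apply: sub_adjoin_mu.
have sE'E : (E' <= E)%VS by apply: adjoin_mu_subP; rewrite ?rpredX.
have galE' s : (s \in 'Gal(E / E')%g) = (s \in 'Gal(E / K)%g) && (s (z ^+ n) == z ^+ n).
  exact: gal_adjoin_mu_fix.
(* [h] and [h'] translate between exponents and automorphisms. Where [h] takes its default 1, [h']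
   returns the exponent of z itself, so the condition h' (h a) = a discards such a. *)
pose h (a : 'I_(m * n)) : gal_of E :=
  odflt 1%g [pick s in 'Gal(E / E')%g | s z == z ^+ a].
pose h' (s : gal_of E) : 'I_(m * n) :=
  odflt (Ordinal N_gt0) [pick a : 'I_(m * n) | s z == z ^+ a].
have h'P (s : gal_of E) : s z = z ^+ h' s.
  rewrite /h'; case: pickP => [a /eqP // | no_a].
  have [|a sza] := prim_rootP prim_z (x := s z).
    by rewrite -rmorphXn (prim_expr_order prim_z) rmorph1.
  by have := no_a a; rewrite sza eqxx.
have hP (a : 'I_(m * n)) s :
    s \in 'Gal(E / E')%g -> s z = z ^+ a -> h a \in 'Gal(E / E')%g /\ h a z = z ^+ a.
  move=> s_gal sz; rewrite /h; case: pickP => [t /andP[t_gal /eqP] // | /(_ s)].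
  by rewrite s_gal sz eqxx.
rewrite /galNorm (reindex_onto h h'); last first.
  move=> s s_gal; have [h_gal hz] := hP _ _ s_gal (h'P s).
  move: h_gal s_gal; rewrite !galE' => /andP[h_gal _] /andP[s_gal _].
  by apply: gal_adjoin_mu_inj => //; rewrite hz -h'P.
apply: eq_big => [a | a /andP[h_gal /eqP h'h]]; last first.
  rewrite rmorphB rmorph1 rmorphM /= h'P h'h.
  by rewrite galE' in h_gal; have /andP[hK _] := h_gal; rewrite (fixed_gal sKE hK).
(* Forwards, z ^+ a is a conjugate of z, hence primitive, so a is prime to m * n; backwards,
   disjointness supplies the automorphism. *)
apply/andP/andP => [[h_gal /eqP h'h] | [co_a a1]].
  have ha_z : h a z = z ^+ a by rewrite h'P h'h.
  split; first by rewrite -(prim_root_exp_coprime _ prim_z) -ha_z fmorph_primitive_root.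
  move: h_gal; rewrite galE' rmorphXn /= ha_z => /andP[_]; rewrite -exprM mulnC exprM.
  by rewrite -[X in _ == X]expr1 (eq_prim_root_expr prim_zn).
have [s s_gal sz] := gal_adjoin_mu_exists phi prim_z co_a disj.
have s_gal' : s \in 'Gal(E / E')%g.
  rewrite galE' s_gal rmorphXn /= sz -exprM [(a * n)%N]mulnC exprM.
  by rewrite -[X in _ == X]expr1 (eq_prim_root_expr prim_zn).
have [h_gal hz] := hP _ _ s_gal' sz; split=> //.
have /eqP := h'P (h a); rewrite hz (eq_prim_root_expr prim_z) !modn_small // => /eqP aE.
exact/eqP/val_inj.
Qed.

End CyclotomicExtension.

(** * The norm relation for [cunit] *)

Theorem theorem1p2
  (D : nat) (hD1 : (1 < D)%N) (hD : squarefree D)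
  (zeta : nat -> algC)
  (hzeta : forall m : nat, (0 < m)%N -> m.-primitive_root (zeta m))
  (hcompat : forall m n : nat, (0 < m)%N -> (0 < n)%N ->
     zeta (m * n)%N ^+ n = zeta m)
  (m n k b n' : nat) (hm : (0 < m)%N) (hn : (0 < n)%N)
  (hmk : (m, k) <> (1%N, 0%N))
  (hbn : n = (b * n')%N) (hn' : coprime n' m)
  (hb : forall p : nat, prime p -> (p %| b)%N -> (p %| m)%N)
  (L : splittingFieldType rat) (phi : {rmorphism L -> algC})
  (sqrtD zm zmn : L)
  (hsqrtD : phi sqrtD = sqrtC D%:R)
  (hzm : phi zm = zeta m) (hzmn : phi zmn = zeta (m * n)%N)
  (K : {subfield L}) (hK : K = <<1; sqrtD>>%AS)
  (u : L) (hu : fundamental_unit phi K u)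
  (eps : L) (heps : eps = norm1_unit K u)
  (hdisj : (K :&: adjoin_mu 1%AS (m * n) zmn)%VS = 1%VS) :
  galNorm (adjoin_mu K m zm) (adjoin_mu K (m * n) zmn) (cunit zmn eps k)
  = \prod_(e <- divisors (radn n'))
      (sigma K m zm (modinv e m) (cunit zm eps ((n %/ e) * k)))
        ^ (mobius e).
Proof.
have phi_inj := fmorph_inj phi.
have prim_zm : m.-primitive_root zm by rewrite -(fmorph_primitive_root phi) hzm hzeta.
have prim_zmn : (m * n).-primitive_root zmn.
  by rewrite -(fmorph_primitive_root phi) hzmn hzeta ?muln_gt0 ?hm.
have zm_eq : zm = zmn ^+ n by apply: phi_inj; rewrite rmorphXn /= hzm hzmn hcompat.
have [[Ku _ _ _] u_gt1 _] := hu.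
have K_eps : eps \in K by rewrite heps /norm1_unit; case: ifP => _; rewrite ?rpredX.
have eps_gt1 : 1 < phi eps.
  by rewrite heps /norm1_unit; case: ifP => _ //; rewrite rmorphXn exprn_egt1.
(* Suppose zm * eps ^+ (k * n) = 1. If k = 0 then zm = 1 and m = 1, which is excluded; otherwise the
   m-th power makes a positive power of [phi eps] > 1 equal to 1. *)
have nz : 1 - zmn ^+ n * (eps ^+ k) ^+ n != 0.
  rewrite -zm_eq -exprM subr_eq0 eq_sym; apply/eqP => zm_eps.
  have [k0 | k_gt0] := posnP k.
    case: hmk; congr (_, _) => //; move: zm_eps; rewrite k0 mul0n mulr1 => zm1.
    by apply/eqP; rewrite -dvdn1 (prim_order_dvd prim_zm) zm1 expr1n.
  have : phi eps ^+ (k * n * m) == 1.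
    rewrite -rmorphXn exprM -[_ ^+ m]mul1r -(prim_expr_order prim_zm) -exprMn zm_eps.
    by rewrite expr1n rmorph1.
  by rewrite gt_eqF // exprn_egt1 // -lt0n !muln_gt0 k_gt0 hn hm.
(* Disjointness descends to level m because Q(mu_m) lies in Q(mu_mn). *)
have disj_m : (K :&: adjoin_mu 1%AS m zm)%VS = 1%VS.
  apply/eqP; rewrite eqEsubv -{1}hdisj capvS ?subvv //=; last first.
    by rewrite zm_eq; apply: adjoin_mu_subP; rewrite ?sub1v ?rpredX ?mem_adjoin_mu.
  by rewrite subv_cap !sub1v.
rewrite /cunit {1}zm_eq (galNorm_adjoin_mu phi prim_zmn hdisj) ?rpredX //.
rewrite (prod_coprime_modn hbn hn' hb prim_zmn nz).
have n'_gt0 : (0 < n')%N by move: hn; rewrite hbn muln_gt0 => /andP[].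
rewrite big_seq [RHS]big_seq; apply: eq_bigr => e.
rewrite -dvdn_divisors ?radn_gt0 // => e_r.
have e_n' := dvdn_trans e_r (radn_dvd n'_gt0).
have ef1 := modinvP (dvdn_gt0 n'_gt0 e_n') (coprime_dvdl e_n' hn').
(* It divides e * modinv e m, which is 1 mod m. *)
have co_fm : coprime (modinv e m) m.
  apply: (@coprime_dvdl _ (e * modinv e m)); rewrite ?dvdn_mull //.
  by rewrite -coprime_modl ef1 coprime_modl coprime1n.
rewrite -/(cunit zm eps _) (sigma_cunit phi) //.
by rewrite zm_eq -!exprM [(k * _)%N]mulnC.
Qed.
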